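(* Let $\mathbb{D}=\{z\in\mathbb{C}:|z|<1\}$. Let $f=h+\overline{g}$ be a sense-preserving univalent harmonic mapping defined on $\mathbb{D}$, with $h,g$ holomorphic in $\mathbb{D}$ and dilatation $\omega=g'/h'$, and suppose that $\Omega=f(\mathbb{D})$ is linearly connected with constant $M$. If $|\omega(z)|<1/(1+M)$ for all $z\in\mathbb{D}$, then $h$ is univalent in $\mathbb{D}$.
   Context: Univalent means injective. A planar harmonic mapping is a complex-valued harmonic function on a domain in $\mathbb{C}$; on $\mathbb{D}$ it can be written $f=h+\overline{g}$ with $h,g$ holomorphic. It is locally univalent and sense-preserving (orientation-preserving) if and only if its Jacobian $|h'|^2-|g'|^2$ is positive, i.e. $|g'|<|h'|$ in $\mathbb{D}$, equivalently $h'(z)\neq 0$ and the dilatation $\omega=g'/h'$ satisfies $|\omega(z)|<1$ in $\mathbb{D}$. A domain $\Omega\subset\mathbb{C}$ is linearly connected with constant $M<\infty$ if any two points $w_1,w_2\in\Omega$ are joined by a path $\gamma\subset\Omega$ of length $l(\gamma)\le M|w_1-w_2|$. *)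

(* Defs.v *)
From Stdlib Require Import Reals.
From Coquelicot Require Import Coquelicot.
Open Scope R_scope.

Definition unit_disk (z : C) : Prop := Cmod z < 1.

Definition image (D : C -> Prop) (f : C -> C) (w : C) : Prop :=
  exists z : C, D z /\ f z = w.

(* The scalar field is forced to be C: this is complex differentiability. *)
Definition holomorphic_on (D : C -> Prop) (f : C -> C) : Prop :=
  forall z : C, D z -> @ex_derive C_AbsRing C_NormedModule f z.

Definition univalent_on (D : C -> Prop) (f : C -> C) : Prop :=
  forall z1 z2 : C, D z1 -> D z2 -> f z1 = f z2 -> z1 = z2.

(* Determinant of the real differential of f = u + iv at z = x + iy,
   namely u_x v_y - u_y v_x; it equals |h'|^2 - |g'|^2 for f = h + conj g
   with h, g holomorphic. *)
Definition jacobian (f : C -> C) (z : C) : R :=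
  Derive (fun x : R => Re (f (x, Im z))) (Re z) *
  Derive (fun y : R => Im (f (Re z, y))) (Im z) -
  Derive (fun y : R => Re (f (Re z, y))) (Im z) *
  Derive (fun x : R => Im (f (x, Im z))) (Re z).

Definition sense_preserving_on (D : C -> Prop) (f : C -> C) : Prop :=
  forall z : C, D z -> 0 < jacobian f z.

(* Meaningful where h' <> 0, which holds wherever h + conj g has positive
   Jacobian. *)
Definition dilatation (h g : C -> C) (z : C) : C :=
  (C_derive g z / C_derive h z)%C.

(* Length of the polygon inscribed in c with vertices
   c (t 0), ..., c (t (S n)); [sum_n] has the n + 1 terms of index 0..n. *)
Definition inscribed_length (c : R -> C) (t : nat -> R) (n : nat) : R :=
  sum_n (fun k : nat => Cmod (c (t (S k)) - c (t k))%C) n.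

Definition subdivision (a b : R) (t : nat -> R) (n : nat) : Prop :=
  t O = a /\ t (S n) = b /\
  (forall k : nat, (k <= n)%nat -> t k <= t (S k)).

(* Equal to p_infty when the restriction of c to [a, b] is not rectifiable. *)
Definition path_length (c : R -> C) (a b : R) : Rbar :=
  Lub_Rbar (fun l : R => exists (n : nat) (t : nat -> R),
    subdivision a b t n /\ l = inscribed_length c t n).

Definition path_in (Omega : C -> Prop) (w1 w2 : C) (c : R -> C) : Prop :=
  continuous_on (fun t : R => 0 <= t <= 1) c /\
  (forall t : R, 0 <= t <= 1 -> Omega (c t)) /\
  c 0 = w1 /\ c 1 = w2.

Definition linearly_connected (Omega : C -> Prop) (M : R) : Prop :=
  forall w1 w2 : C, Omega w1 -> Omega w2 ->
    exists c : R -> C, path_in Omega w1 w2 c /\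
      Rbar_le (path_length c 0 1) (Finite (M * Cmod (w1 - w2)%C)).

(* Main.v *)
Require Import Defs.
From Stdlib Require Import Reals Arith Lra Lia ClassicalEpsilon.
From Coquelicot Require Import Coquelicot.
Open Scope R_scope.

(** Suppose [h z1 = h z2] with [z1 <> z2], and let [c] be a path in the image
    of [f] from [f z1] to [f z2] of length at most [M |f z1 - f z2|]. Since
    [f = h + conj g], the distance [|f z1 - f z2|] equals [|g z1 - g z2|]. On
    the other hand, [|g'| / (|h'| - |g'|)] bounds the rate at which [g] changes
    with respect to [f], and [|g' / h'| < 1 / (1 + M)] makes it less than
    [1 / M]. Lifting [c] to the disk by the inverse of [f] gives
    [|g z1 - g z2| < (1 / M) M |f z1 - f z2|], a contradiction.

    Everything is derived from the first-order expansions of [f], [g] and [h]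
    at single points ([wirtinger_at]).

    - The inverse of [f] is continuous because [f] maps each small disk around
      [z0] onto a neighbourhood of [f z0] ([wirtinger_locally_onto]). For [w]
      close to [f z0], the function [|f - w|] on a closed disk has its minimum
      in the interior, as [|f - f z0|] grows at least linearly near [z0]. At
      an interior point with [f p <> w], the differential, being invertible,
      offers a direction in which [|f - w|] decreases ([wirtinger_descent]);
      so the minimum is zero.

    - The comparison of [g] with [f] is local around each point of the path,
      with a constant that depends on the point
      ([conjugate_part_locally_dominated]). Induction along the parameter
      interval chains finitely many of these comparisons into one inscribed
      polygon ([variation_along_path]). The largest of the finitely many
      constants is still less than [1 / M], which gives the strict inequality
      of the contradiction. *)

(** * First-order expansions of planar maps *)

Lemma unit_disk_open (z z' : C) :
  Cmod (z' - z) < 1 - Cmod z -> unit_disk z'.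
Proof.
  intros H; unfold unit_disk.
  replace z' with ((z' - z) + z)%C by ring.
  generalize (Cmod_triangle (z' - z) z); lra.
Qed.

Lemma Cmod_reverse_triangle (x y : C) : Cmod x - Cmod y <= Cmod (x + y).
Proof.
  generalize (Cmod_triangle (x + y) (- y)); rewrite Cmod_opp.
  replace (x + y + - y)%C with x by ring; lra.
Qed.

Lemma Cmod_le_Re_Im (x : C) : Cmod x <= Rabs (Re x) + Rabs (Im x).
Proof.
  apply Rsqr_incr_0_var.
  - rewrite !Rsqr_pow2, Cmod2_alt, <- (pow2_abs (Re x)), <- (pow2_abs (Im x)).
    generalize (Rabs_pos (Re x)) (Rabs_pos (Im x)); nra.
  - generalize (Rabs_pos (Re x)) (Rabs_pos (Im x)); lra.
Qed.

(** The real differential of [f] at [z] is [u |-> a u + conj (b u)], so that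
    [a] and [conj b] are the Wirtinger derivatives of [f]. With the conjugate
    outside, [a = h'] and [b = g'] when [f = h + conj g]. *)
Definition wirtinger_at (f : C -> C) (z a b : C) : Prop :=
  forall eps, 0 < eps -> exists delta, 0 < delta /\
    forall z', Cmod (z' - z) < delta ->
      Cmod (f z' - f z - (a * (z' - z) + Cconj (b * (z' - z)))) <=
      eps * Cmod (z' - z).

Lemma wirtinger_at_holomorphic (f : C -> C) (z : C) :
  @ex_derive C_AbsRing C_NormedModule f z ->
  wirtinger_at f z (C_derive f z) 0.
Proof.
  intros Hf%(C_derive_correct f z z) eps Heps.
  destruct Hf as [_ Hf].
  destruct (Hf z (fun P HP => HP) (mkposreal eps Heps)) as [d Hd].
  exists d; split; [apply cond_pos|].
  intros z' Hz'; specialize (Hd z' Hz').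
  replace (Cconj (0 * (z' - z))) with (RtoC 0).
  2: { rewrite Cmult_0_l; apply injective_projections; simpl; ring. }
  replace (f z' - f z - (C_derive f z * (z' - z) + 0))%C
    with (f z' - f z - (z' - z) * C_derive f z)%C by ring.
  exact Hd.
Qed.

Lemma wirtinger_at_harmonic (f h g : C -> C) (z a b : C) (r : R) :
  0 < r ->
  (forall z', Cmod (z' - z) < r -> f z' = (h z' + Cconj (g z'))%C) ->
  wirtinger_at h z a 0 -> wirtinger_at g z b 0 -> wirtinger_at f z a b.
Proof.
  intros Hr Hf Hh Hg eps Heps.
  destruct (Hh (eps / 2)) as [d1 [Hd1 H1]]; [lra|].
  destruct (Hg (eps / 2)) as [d2 [Hd2 H2]]; [lra|].
  exists (Rmin r (Rmin d1 d2)); split; [repeat apply Rmin_glb_lt; assumption|].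
  intros z' Hz'.
  apply Rmin_Rgt_l in Hz' as [Hzr Hz']; apply Rmin_Rgt_l in Hz' as [Hz1 Hz2].
  specialize (H1 z' Hz1); specialize (H2 z' Hz2).
  rewrite (Hf z' Hzr), (Hf z).
  2: { replace (z - z)%C with (RtoC 0) by ring; rewrite Cmod_0; exact Hr. }
  rewrite <- Cmod_conj in H2.
  match goal with |- Cmod ?x <= _ =>
    match type of H1 with Cmod ?u <= _ =>
    match type of H2 with Cmod ?v <= _ =>
      replace x with (u + v)%C;
      [generalize (Cmod_triangle u v); lra|] end end end.
  apply injective_projections; simpl; ring.
Qed.

Lemma wirtinger_at_lower (f : C -> C) (z a b : C) (c : R) :
  wirtinger_at f z a b -> c < Cmod a - Cmod b ->
  exists delta, 0 < delta /\ forall z', Cmod (z' - z) < delta ->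
    c * Cmod (z' - z) <= Cmod (f z' - f z).
Proof.
  intros Hf Hc.
  destruct (Hf (Cmod a - Cmod b - c)) as [d [Hd H]]; [lra|].
  exists d; split; [exact Hd|]; intros z' Hz'; specialize (H z' Hz').
  set (u := (z' - z)%C) in *; set (v := (f z' - f z)%C) in *.
  generalize (Cmod_triangle (v - (a * u + Cconj (b * u))) (Cconj (b * u)))
    (Cmod_reverse_triangle (a * u) (v - (a * u + Cconj (b * u)) + Cconj (b * u))).
  replace (a * u + (v - (a * u + Cconj (b * u)) + Cconj (b * u)))%C
    with v by ring.
  rewrite Cmod_conj, !Cmod_mult; lra.
Qed.

Lemma wirtinger_at_upper (f : C -> C) (z a b : C) (c : R) :
  wirtinger_at f z a b -> Cmod a + Cmod b < c ->
  exists delta, 0 < delta /\ forall z', Cmod (z' - z) < delta ->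
    Cmod (f z' - f z) <= c * Cmod (z' - z).
Proof.
  intros Hf Hc.
  destruct (Hf (c - Cmod a - Cmod b)) as [d [Hd H]]; [lra|].
  exists d; split; [exact Hd|]; intros z' Hz'; specialize (H z' Hz').
  set (u := (z' - z)%C) in *; set (v := (f z' - f z)%C) in *.
  generalize (Cmod_triangle (v - (a * u + Cconj (b * u))) (a * u + Cconj (b * u)))
    (Cmod_triangle (a * u) (Cconj (b * u))).
  replace (v - (a * u + Cconj (b * u)) + (a * u + Cconj (b * u)))%C
    with v by ring.
  rewrite Cmod_conj, !Cmod_mult; lra.
Qed.

(** [lambda] stands for the real or the imaginary part, and [gamma] for a
    horizontal or a vertical line through [z]: the four partial derivatives in
    the Jacobian are the four cases. *)
Lemma wirtinger_at_partial (f : C -> C) (z a b : C)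
  (lambda : C -> R) (gamma : R -> C) (t : R) (v : C) :
  wirtinger_at f z a b ->
  (forall x y, lambda (x - y)%C = lambda x - lambda y) ->
  (forall (r : R) x, lambda (r * x)%C = r * lambda x) ->
  (forall x, Rabs (lambda x) <= Cmod x) ->
  gamma t = z -> (forall s, gamma (t + s) = (z + s * v)%C) -> Cmod v = 1 ->
  Derive (fun s => lambda (f (gamma s))) t = lambda (a * v + Cconj (b * v))%C.
Proof.
  intros Hf Hsub Hscal Hbd Ht Hg Hv.
  apply is_derive_unique, is_derive_Reals; intros eps Heps.
  destruct (Hf (eps / 2)) as [d [Hd H]]; [lra|].
  exists (mkposreal d Hd); simpl; intros s Hs0 Hs.
  rewrite Ht, Hg.
  specialize (H (z + s * v)%C).
  replace (z + s * v - z)%C with (s * v)%C in H by ring.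
  rewrite !Cmod_mult, Cmod_R, Hv, Rmult_1_r in H.
  specialize (H Hs).
  replace ((lambda (f (z + s * v)%C) - lambda (f z)) / s -
    lambda (a * v + Cconj (b * v))%C)
    with (lambda (f (z + s * v) - f z -
            (a * (s * v) + Cconj (b * (s * v))))%C / s).
  2: { replace (a * (s * v) + Cconj (b * (s * v)))%C
         with (s * (a * v + Cconj (b * v)))%C
         by (apply injective_projections; simpl; ring).
       rewrite !Hsub, Hscal; field; exact Hs0. }
  unfold Rdiv; rewrite Rabs_mult, Rabs_inv.
  apply Rabs_pos_lt in Hs0.
  apply Rle_lt_trans with (eps / 2); [|lra].
  apply Rmult_le_reg_r with (Rabs s); [exact Hs0|].
  rewrite Rmult_assoc, Rinv_l, Rmult_1_r by lra.
  eapply Rle_trans; [apply Hbd|exact H].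
Qed.

Lemma jacobian_wirtinger (f : C -> C) (z a b : C) :
  wirtinger_at f z a b -> jacobian f z = Cmod a ^ 2 - Cmod b ^ 2.
Proof.
  intros Hf; unfold jacobian.
  assert (ReB : forall x y, Re (x - y)%C = Re x - Re y)
    by (intros; unfold Re, Im; simpl; ring).
  assert (ImB : forall x y, Im (x - y)%C = Im x - Im y)
    by (intros; unfold Re, Im; simpl; ring).
  assert (ReZ : forall (r : R) x, Re (r * x)%C = r * Re x)
    by (intros; unfold Re, Im; simpl; ring).
  assert (ImZ : forall (r : R) x, Im (r * x)%C = r * Im x)
    by (intros; unfold Re, Im; simpl; ring).
  assert (ImM : forall x, Rabs (Im x) <= Cmod x)
    by (intros x; eapply Rle_trans; [apply Rmax_r|apply Rmax_Cmod]).
  assert (Hx : forall s : R, (Re z + s, Im z) = (z + s * 1)%C)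
    by (intros; apply injective_projections; unfold Re, Im; simpl; ring).
  assert (Hy : forall s : R, (Re z, Im z + s) = (z + s * Ci)%C)
    by (intros; apply injective_projections; unfold Re, Im; simpl; ring).
  assert (Hz : (Re z, Im z) = z) by (destruct z; reflexivity).
  rewrite (wirtinger_at_partial f z a b Re (fun s => (s, Im z)) (Re z) 1)
    by (auto using re_le_Cmod, Cmod_1).
  rewrite (wirtinger_at_partial f z a b Im (fun s => (s, Im z)) (Re z) 1)
    by (auto using Cmod_1).
  rewrite (wirtinger_at_partial f z a b Re (fun s => (Re z, s)) (Im z) Ci)
    by (auto using re_le_Cmod, Cmod_Ci).
  rewrite (wirtinger_at_partial f z a b Im (fun s => (Re z, s)) (Im z) Ci)
    by (auto using Cmod_Ci).
  rewrite !Cmod2_alt; unfold Re, Im; simpl; ring.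
Qed.

(** * Minimisation on a closed disk and local surjectivity *)

(** A small step [t u] from [p], where the differential sends [u] to [w - f p],
    multiplies [f p - w] by [1 - t] up to an error [o(t)]. *)
Lemma wirtinger_descent (f : C -> C) (p a b w : C) (delta : R) :
  wirtinger_at f p a b -> Cmod b < Cmod a -> f p <> w -> 0 < delta ->
  exists q, Cmod (q - p) < delta /\ Cmod (f q - w) < Cmod (f p - w).
Proof.
  intros Hf Hab Hw Hdelta.
  set (v := (w - f p)%C).
  assert (Hv : 0 < Cmod v).
  { apply Cmod_gt_0; intros E; apply Hw; unfold v in E.
    replace w with (w - f p + f p)%C by ring; rewrite E; ring. }
  assert (Hk : exists k, k * (Re a ^ 2 + Im a ^ 2 - (Re b ^ 2 + Im b ^ 2)) = 1).
  { exists (/ (Re a ^ 2 + Im a ^ 2 - (Re b ^ 2 + Im b ^ 2))).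
    rewrite <- !Cmod2_alt; field; generalize (Cmod_ge_0 b); nra. }
  destruct Hk as [k Hk].
  (* Cramer's solution of [a u + conj (b u) = v]; [k] is the inverse of the
     determinant [|a|^2 - |b|^2]. *)
  set (u := (k * (Cconj a * v - Cconj b * Cconj v))%C).
  assert (Hu : (a * u + Cconj (b * u))%C = v).
  { apply injective_projections.
    - transitivity (fst v * (k * (Re a ^ 2 + Im a ^ 2 - (Re b ^ 2 + Im b ^ 2))));
        [unfold u, Re, Im; simpl; ring|rewrite Hk; ring].
    - transitivity (snd v * (k * (Re a ^ 2 + Im a ^ 2 - (Re b ^ 2 + Im b ^ 2))));
        [unfold u, Re, Im; simpl; ring|rewrite Hk; ring]. }
  assert (Hu0 : 0 < 1 + Cmod u) by (generalize (Cmod_ge_0 u); lra).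
  destruct (Hf (Cmod v / (2 * (1 + Cmod u)))) as [d [Hd H]].
  { apply Rdiv_lt_0_compat; lra. }
  set (m := Rmin d delta).
  assert (Hm : 0 < m) by (apply Rmin_glb_lt; assumption).
  set (t := Rmin 1 (m / (1 + Cmod u))).
  assert (Ht : 0 < t).
  { apply Rmin_glb_lt; [lra|apply Rdiv_lt_0_compat; lra]. }
  assert (Ht1 : t <= 1) by apply Rmin_l.
  assert (Htu : Cmod (t * u) < m).
  { rewrite Cmod_mult, Cmod_R, Rabs_pos_eq by lra.
    apply Rlt_le_trans with (t * (1 + Cmod u)); [nra|].
    apply Rle_trans with (m / (1 + Cmod u) * (1 + Cmod u)).
    - apply Rmult_le_compat_r; [lra|apply Rmin_r].
    - right; field; lra. }
  exists (p + t * u)%C.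
  replace (p + t * u - p)%C with (t * u)%C by ring.
  apply Rmin_Rgt_l in Htu as [Htd Htdelta]; split; [exact Htdelta|].
  specialize (H (p + t * u)%C).
  replace (p + t * u - p)%C with (t * u)%C in H by ring.
  specialize (H Htd).
  replace (a * (t * u) + Cconj (b * (t * u)))%C with (t * v)%C in H.
  2: { rewrite <- Hu; apply injective_projections; simpl; ring. }
  set (e := (f (p + t * u) - f p - t * v)%C) in H.
  replace (f (p + t * u)%C - w)%C with (e + - ((1 - t)%R * v))%C.
  2: { unfold e, v; rewrite RtoC_minus; ring. }
  replace (f p - w)%C with (- v)%C by (unfold v; ring).
  generalize (Cmod_triangle e (- ((1 - t)%R * v))).
  rewrite !Cmod_opp, Cmod_mult, Cmod_R, (Rabs_pos_eq (1 - t)) by lra.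
  assert (Cmod v / (2 * (1 + Cmod u)) * Cmod (t * u) < t * Cmod v).
  { rewrite Cmod_mult, Cmod_R, (Rabs_pos_eq t) by lra.
    apply Rle_lt_trans with (t * Cmod v * / 2).
    - apply Rmult_le_reg_r with (2 * (1 + Cmod u)); [lra|].
      field_simplify; [|lra..].
      assert (0 < t * Cmod v) by nra; nra.
    - nra. }
  lra.
Qed.

(** Heine-Borel. The local gain [e] serves both as the radius of the
    neighbourhood and as the gap above [m], so that the positive lower bound
    which compactness gives for the radii is also a uniform gap. *)
Lemma bounded_uniform_lower_bound (K : C -> Prop) (r : R) (F : C -> R) (m : R) :
  (forall q, K q -> Cmod q <= r) ->
  (forall p, exists e, 0 < e /\
     forall q, K q -> Cmod (q - p) < e -> m + e <= F q) ->
  exists d, 0 < d /\ forall q, K q -> m + d <= F q.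
Proof.
  intros HK Hloc.
  pose (gauge := fun p => proj1_sig (constructive_indefinite_description _ (Hloc p))).
  assert (Hg : forall p, 0 < gauge p /\
     forall q, K q -> Cmod (q - p) < gauge p -> m + gauge p <= F q).
  { intros p; unfold gauge.
    destruct (constructive_indefinite_description _ (Hloc p)); assumption. }
  assert (Hg2 : forall u v, 0 < gauge (u, v) / 2)
    by (intros u v; destruct (Hg (u, v)); lra).
  destruct (compactness_value_2d (- r) r (- r) r
    (fun u v => mkposreal _ (Hg2 u v))) as [d Hd].
  exists d; split; [apply cond_pos|].
  intros q Hq; destruct (Rle_dec (m + d) (F q)) as [|Hn]; [assumption|].
  exfalso.
  generalize (re_le_Cmod q) (Rmax_Cmod q) (HK q Hq); intros H1 H2 H3.
  generalize (Rmax_r (Rabs (fst q)) (Rabs (snd q))); intros H4.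
  apply (Hd (Re q) (Im q)).
  - apply Rabs_le_between; lra.
  - apply Rabs_le_between; unfold Im; lra.
  - intros (u & v & _ & _ & Hu & Hv & Hduv); simpl in *; apply Hn.
    destruct (Hg (u, v)) as [Hpos Hlow].
    apply Rle_trans with (m + gauge (u, v)); [lra|].
    apply Hlow; [exact Hq|].
    eapply Rle_lt_trans; [apply Cmod_le_Re_Im|].
    simpl; unfold Re, Im, Rminus in *; lra.
Qed.

(** If the infimum were not attained, semicontinuity would give a local gap
    above it around each point, hence a uniform one. *)
Lemma closed_disk_min (z0 : C) (r : R) (F : C -> R) :
  0 <= r ->
  (forall q, 0 <= F q) ->
  (forall p, Cmod (p - z0) <= r -> forall e, 0 < e -> exists delta, 0 < delta /\
     forall q, Cmod (q - p) < delta -> F p - e <= F q) ->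
  exists p, Cmod (p - z0) <= r /\
    forall q, Cmod (q - z0) <= r -> F p <= F q.
Proof.
  intros Hr Hpos Hlsc.
  destruct (completeness (fun x => exists q, Cmod (q - z0) <= r /\ x = - F q))
    as [m [Hub Hlub]].
  { exists 0; intros x (q & _ & ->); specialize (Hpos q); lra. }
  { exists (- F z0), z0; split; [|reflexivity].
    replace (z0 - z0)%C with (RtoC 0) by ring; rewrite Cmod_0; exact Hr. }
  assert (Hm : forall q, Cmod (q - z0) <= r -> - m <= F q).
  { intros q Hq; enough (- F q <= m) by lra; apply Hub; eauto. }
  destruct (excluded_middle_informative
    (exists p, Cmod (p - z0) <= r /\ F p <= - m)) as [(p & Hp & HFp)|Hno].
  { exists p; split; [exact Hp|]; intros q Hq; specialize (Hm q Hq); lra. }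
  exfalso.
  destruct (bounded_uniform_lower_bound (fun q => Cmod (q - z0) <= r)
    (r + Cmod z0) F (- m)) as [d [Hd Hlow]].
  - intros q Hq; generalize (Cmod_triangle (q - z0) z0).
    replace (q - z0 + z0)%C with q by ring; lra.
  - intros p; destruct (Rle_dec (Cmod (p - z0)) r) as [Hp|Hp].
    + assert (Hgap : - m < F p)
        by (apply Rnot_le_lt; intros Hle; apply Hno; eauto).
      destruct (Hlsc p Hp ((F p + m) / 2)) as [delta [Hdelta H]]; [lra|].
      exists (Rmin delta ((F p + m) / 2)); split; [apply Rmin_glb_lt; lra|].
      intros q _ Hq; apply Rmin_Rgt_l in Hq as [Hq _]; specialize (H q Hq).
      generalize (Rmin_r delta ((F p + m) / 2)); lra.
    + exists (Cmod (p - z0) - r); split; [lra|].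
      intros q Hq Hqp; exfalso; apply Hp.
      generalize (Cmod_triangle (q - z0) (- (q - p))); rewrite Cmod_opp.
      replace (q - z0 + - (q - p))%C with (p - z0)%C by ring; lra.
  - enough (m <= m - d) by lra.
    apply Hlub; intros x (q & Hq & ->); specialize (Hlow q Hq); lra.
Qed.

(** The minimum of [|f - w|] on a small closed disk around [z0] is attained
    inside it and, by [wirtinger_descent], can only be zero. *)
Lemma wirtinger_locally_onto (f A B : C -> C) (z0 : C) (r : R) :
  0 < r ->
  (forall z, Cmod (z - z0) < r ->
     wirtinger_at f z (A z) (B z) /\ Cmod (B z) < Cmod (A z)) ->
  exists rho, 0 < rho /\ forall w, Cmod (w - f z0) < rho ->
    exists p, Cmod (p - z0) < r /\ f p = w.
Proof.
  intros Hr Hf.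
  assert (H00 : Cmod (z0 - z0) = 0)
    by (replace (z0 - z0)%C with (RtoC 0) by ring; apply Cmod_0).
  destruct (Hf z0) as [Hf0 Hab0]; [lra|].
  set (c := (Cmod (A z0) - Cmod (B z0)) / 2).
  destruct (wirtinger_at_lower f z0 _ _ c Hf0) as [d [Hd Hlow]].
  { unfold c; lra. }
  assert (Hc : 0 < c) by (unfold c; lra).
  set (s := Rmin r d / 2).
  assert (Hmin : 0 < Rmin r d) by (apply Rmin_glb_lt; assumption).
  assert (Hs : 0 < s) by (unfold s; lra).
  assert (Hsr : s < r) by (unfold s; generalize (Rmin_l r d); lra).
  assert (Hsd : s < d) by (unfold s; generalize (Rmin_r r d); lra).
  (* On the circle of radius [s], [|f - f z0|] is at least [c s]; hence if
     [|w - f z0| < c s / 2], then [|f - w|] is smaller at [z0] than there. *)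
  exists (c * s / 2); split; [nra|]; intros w Hw.
  destruct (closed_disk_min z0 s (fun z => Cmod (f z - w))) as [p [Hp Hmp]].
  - lra.
  - intros q; apply Cmod_ge_0.
  - intros p Hp e He; destruct (Hf p) as [Hfp _]; [lra|].
    set (k := Cmod (A p) + Cmod (B p) + 1).
    assert (Hk : 0 < k)
      by (unfold k; generalize (Cmod_ge_0 (A p)) (Cmod_ge_0 (B p)); lra).
    destruct (wirtinger_at_upper f p _ _ k Hfp) as [d' [Hd' Hup]].
    { unfold k; lra. }
    exists (Rmin d' (e / k)); split.
    { apply Rmin_glb_lt; [assumption|apply Rdiv_lt_0_compat; assumption]. }
    intros q Hq; apply Rmin_Rgt_l in Hq as [Hq1 Hq2]; specialize (Hup q Hq1).
    assert (k * Cmod (q - p) <= e).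
    { apply Rle_trans with (k * (e / k)); [nra|right; field; lra]. }
    generalize (Cmod_triangle (f q - w) (- (f q - f p))); rewrite Cmod_opp.
    replace (f q - w + - (f q - f p))%C with (f p - w)%C by ring; lra.
  - assert (Hps : Cmod (p - z0) < s).
    { specialize (Hmp z0 ltac:(lra)); simpl in Hmp.
      replace (f z0 - w)%C with (- (w - f z0))%C in Hmp by ring.
      rewrite Cmod_opp in Hmp.
      specialize (Hlow p ltac:(lra)).
      generalize (Cmod_triangle (f p - w) (w - f z0)).
      replace (f p - w + (w - f z0))%C with (f p - f z0)%C by ring.
      intros; nra. }
    exists p; split; [lra|].
    destruct (excluded_middle_informative (f p = w)) as [|Hne]; [assumption|].
    exfalso; destruct (Hf p) as [Hfp Habp]; [lra|].
    destruct (wirtinger_descent f p _ _ w (s - Cmod (p - z0)) Hfp Habp Hne)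
      as [q [Hq Hlt]]; [lra|].
    apply (Rlt_not_le _ _ Hlt), Hmp.
    generalize (Cmod_triangle (q - p) (p - z0)).
    replace (q - p + (p - z0))%C with (q - z0)%C by ring; lra.
Qed.

(** * Induction along an interval *)

(** A form of Cousin's lemma. If [x] is the supremum of the points where [P]
    holds, the step at [x] carries [P] from just before [x] to just after it,
    so [x = b]. Since the step has to straddle [x], estimates based at the
    single point [x] suffice to prove it. *)
Lemma interval_induction (P : R -> Prop) (a b : R) :
  a <= b -> P a ->
  (forall x, a <= x <= b -> exists delta, 0 < delta /\
     forall s s', a <= s <= x -> x <= s' <= b ->
       x - s < delta -> s' - x < delta -> P s -> P s') ->
  P b.
Proof.
  intros Hab Ha Hstep.
  destruct (completeness (fun x => a <= x <= b /\ P x)) as [m [Hub Hlub]].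
  { exists b; intros x [[_ H] _]; exact H. }
  { exists a; split; [lra|exact Ha]. }
  assert (Ham : a <= m) by (apply Hub; split; [lra|exact Ha]).
  assert (Hmb : m <= b) by (apply Hlub; intros x [[_ H] _]; exact H).
  destruct (Hstep m (conj Ham Hmb)) as [d [Hd H]].
  destruct (excluded_middle_informative
    (exists s, (a <= s <= b /\ P s) /\ m - d < s)) as [(s & [Hs HPs] & Hsd)|Hno].
  2: { exfalso; enough (m <= m - d) by lra.
       apply Hlub; intros x Hx; apply Rnot_lt_le; intros Hlt; apply Hno; eauto. }
  assert (Hsm : s <= m) by (apply Hub; split; assumption).
  destruct (Rle_lt_or_eq_dec m b Hmb) as [Hlt|Heq].
  2: { apply (H s b); [lra..|exact HPs]. }
  exfalso.
  set (s' := Rmin b (m + d / 2)).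
  assert (Hs' : m < s') by (apply Rmin_glb_lt; lra).
  assert (Hs'b : s' <= b) by apply Rmin_l.
  assert (Hs'd : s' <= m + d / 2) by apply Rmin_r.
  apply (Rlt_not_le _ _ Hs'), Hub; split; [lra|].
  apply (H s s'); [lra..|exact HPs].
Qed.

(** * Inscribed polygons *)

Lemma inscribed_length_le_path_length (c : R -> C) (a b L : R) (t : nat -> R) (n : nat) :
  Rbar_le (path_length c a b) (Finite L) -> Defs.subdivision a b t n ->
  inscribed_length c t n <= L.
Proof.
  intros HL Ht.
  destruct (Lub_Rbar_correct (fun l : R => exists (n : nat) (t : nat -> R),
    Defs.subdivision a b t n /\ l = inscribed_length c t n)) as [Hub _].
  specialize (Hub (inscribed_length c t n)
    (ex_intro _ n (ex_intro _ t (conj Ht eq_refl)))).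
  exact (Rbar_le_trans _ _ _ Hub HL).
Qed.

Lemma inscribed_length_ge_0 (c : R -> C) (t : nat -> R) (n : nat) :
  0 <= inscribed_length c t n.
Proof.
  unfold inscribed_length; induction n as [|n IH].
  - rewrite sum_O; apply Cmod_ge_0.
  - rewrite sum_Sn; apply Rplus_le_le_0_compat; [exact IH|apply Cmod_ge_0].
Qed.

Lemma subdivision_extend (c : R -> C) (a x y : R) (t : nat -> R) (n : nat) :
  Defs.subdivision a x t n -> x <= y ->
  exists t', Defs.subdivision a y t' (S n) /\
    inscribed_length c t' (S n) = inscribed_length c t n + Cmod (c y - c x).
Proof.
  intros (H0 & Hn & Hmono) Hxy.
  exists (fun k => if le_lt_dec k (S n) then t k else y).
  split; [split; [|split]|].
  - exact H0.
  - destruct (le_lt_dec (S (S n)) (S n)); [lia|reflexivity].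
  - intros k Hk.
    destruct (le_lt_dec k (S n)); [|lia].
    destruct (le_lt_dec (S k) (S n)); [apply Hmono; lia|].
    replace k with (S n) by lia; lra.
  - unfold inscribed_length; rewrite sum_Sn.
    apply (f_equal2 Rplus).
    + apply sum_n_ext_loc; intros k Hk.
      destruct (le_lt_dec (S k) (S n)); [|lia].
      destruct (le_lt_dec k (S n)); [reflexivity|lia].
    + destruct (le_lt_dec (S (S n)) (S n)); [lia|].
      destruct (le_lt_dec (S n) (S n)); [|lia].
      rewrite Hn; reflexivity.
Qed.

(** * Comparing the variation of g with that of f *)

(** With [a = h'(z)] and [b = g'(z)], near [z] the increment of [g] is at most
    about [|b| |dz|], while that of [f] is at least about [(|a| - |b|) |dz|].
    The hypothesis [(1 + M) |b| < |a|] says exactly that the quotient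
    [|b| / (|a| - |b|)] is smaller than [1 / M], with room for the errors. *)
Lemma conjugate_part_locally_dominated (f h g : C -> C) (z a b : C) (M r : R) :
  0 < r -> 0 <= M ->
  (forall z', Cmod (z' - z) < r -> f z' = (h z' + Cconj (g z'))%C) ->
  wirtinger_at h z a 0 -> wirtinger_at g z b 0 ->
  (1 + M) * Cmod b < Cmod a ->
  exists k delta, 0 <= k /\ k * M < 1 /\ 0 < delta /\
    forall z', Cmod (z' - z) < delta ->
      Cmod (g z' - g z) <= k * Cmod (f z' - f z).
Proof.
  intros Hr HM Hf Hh Hg Hab.
  (* Half of what makes [M (|b| + eps) = |a| - |b| - eps]. *)
  set (eps := (Cmod a - (1 + M) * Cmod b) / (2 * (1 + M))).
  assert (Heps : 0 < eps) by (apply Rdiv_lt_0_compat; lra).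
  assert (Heps2 : (1 + M) * eps = (Cmod a - (1 + M) * Cmod b) / 2)
    by (unfold eps; field; lra).
  assert (Hb := Cmod_ge_0 b).
  set (c := Cmod a - Cmod b - eps).
  assert (Hc : M * (Cmod b + eps) < c) by (unfold c; nra).
  assert (Hc0 : 0 < c) by nra.
  destruct (wirtinger_at_upper g z b 0 (Cmod b + eps) Hg) as [d1 [Hd1 H1]].
  { rewrite Cmod_0; lra. }
  destruct (wirtinger_at_lower f z a b c) as [d2 [Hd2 H2]].
  { exact (wirtinger_at_harmonic f h g z a b r Hr Hf Hh Hg). }
  { unfold c; lra. }
  exists ((Cmod b + eps) / c), (Rmin d1 d2); repeat split.
  - apply Rlt_le, Rdiv_lt_0_compat; lra.
  - apply Rmult_lt_reg_r with c; [exact Hc0|]; field_simplify; lra.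
  - apply Rmin_glb_lt; assumption.
  - intros z' Hz'; apply Rmin_Rgt_l in Hz' as [Hz1 Hz2].
    specialize (H1 z' Hz1); specialize (H2 z' Hz2).
    eapply Rle_trans; [exact H1|].
    apply Rle_trans with ((Cmod b + eps) / c * (c * Cmod (z' - z))).
    + right; field; lra.
    + apply Rmult_le_compat_l; [|exact H2].
      apply Rlt_le, Rdiv_lt_0_compat; lra.
Qed.

Lemma continuous_on_Cmod (D : R -> Prop) (c : R -> C) (t eps : R) :
  continuous_on D c -> D t -> 0 < eps ->
  exists delta, 0 < delta /\
    forall s, D s -> Rabs (s - t) < delta -> Cmod (c s - c t) < eps.
Proof.
  intros Hc Ht Heps.
  destruct (Hc t Ht (fun w => Cmod (w - c t) < eps)) as [d Hd].
  { exact (@locally_ball_norm C_AbsRing C_NormedModule (c t) (mkposreal eps Heps)). }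
  exists d; split; [apply cond_pos|]; intros s Hs Hst; exact (Hd s Hst Hs).
Qed.

(** Induction on the parameter [x] of the path: [P x] bounds the variation of
    [g] from [z1] to the point of [D] above [c x] by [k] times the length of a
    polygon inscribed in [c]. The constant [k] and the polygon change as [x]
    advances, but each advance takes the maximum of two constants, so the
    bound [k * M < 1] survives. *)
Lemma variation_along_path (D : C -> Prop) (f g : C -> C) (c : R -> C)
  (M L : R) (z1 z2 : C) :
  (forall z, D z -> exists k delta, 0 <= k /\ k * M < 1 /\ 0 < delta /\
     forall z', D z' -> Cmod (z' - z) < delta ->
       Cmod (g z' - g z) <= k * Cmod (f z' - f z)) ->
  (forall z r, D z -> 0 < r -> exists rho, 0 < rho /\
     forall z', D z' -> Cmod (f z' - f z) < rho -> Cmod (z' - z) < r) ->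
  path_in (image D f) (f z1) (f z2) c ->
  Rbar_le (path_length c 0 1) (Finite L) ->
  D z1 -> D z2 -> univalent_on D f ->
  exists k, 0 <= k /\ k * M < 1 /\ Cmod (g z2 - g z1) <= k * L.
Proof.
  intros Hloc Hinv (Hcont & Hin & Hc0 & Hc1) Hlen Hz1 Hz2 Huniv.
  set (P := fun x => exists k n t, 0 <= k /\ k * M < 1 /\
    Defs.subdivision 0 x t n /\
    forall z, D z -> f z = c x -> Cmod (g z - g z1) <= k * inscribed_length c t n).
  (* One more edge of the polygon, from [c x] to [c y]. *)
  assert (Hext : forall x y k, 0 <= x -> x <= y -> y <= 1 -> 0 <= k -> k * M < 1 ->
    (forall z z', D z -> D z' -> f z = c x -> f z' = c y ->
       Cmod (g z' - g z) <= k * Cmod (c y - c x)) -> P x -> P y).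
  { intros x y k Hx Hxy Hy Hk HkM Hstep (k0 & n & t & Hk0 & Hk0M & Ht & HP).
    destruct (subdivision_extend c 0 x y t n Ht Hxy) as (t' & Ht' & Hl).
    exists (Rmax k0 k), (S n), t'; rewrite Hl.
    split; [|split; [|split; [exact Ht'|]]].
    - eapply Rle_trans; [exact Hk|apply Rmax_r].
    - apply Rmax_case; assumption.
    - intros z' Hz' Hfz'.
      destruct (Hin x) as (z & Hz & Hfz); [lra|].
      specialize (HP z Hz Hfz); specialize (Hstep z z' Hz Hz' Hfz Hfz').
      generalize (Cmod_triangle (g z' - g z) (g z - g z1)).
      replace (g z' - g z + (g z - g z1))%C with (g z' - g z1)%C by ring.
      generalize (Rmult_le_compat_r _ _ _ (inscribed_length_ge_0 c t n) (Rmax_l k0 k))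
        (Rmult_le_compat_r _ _ _ (Cmod_ge_0 (c y - c x)) (Rmax_r k0 k)); lra. }
  assert (HP1 : P 1).
  { apply (interval_induction P 0 1); [lra| |].
    - exists 0, 0%nat, (fun _ => 0); split; [lra|split; [lra|split]].
      + split; [reflexivity|split; [reflexivity|intros; lra]].
      + intros z Hz Hfz; replace z with z1 by (apply Huniv; congruence).
        replace (g z1 - g z1)%C with (RtoC 0) by ring; rewrite Cmod_0; lra.
    - intros x Hx.
      destruct (Hin x Hx) as (z & Hz & Hfz).
      destruct (Hloc z Hz) as (k & r & Hk & HkM & Hr & Hg).
      destruct (Hinv z r Hz Hr) as (rho & Hrho & Hback).
      destruct (continuous_on_Cmod _ c x rho Hcont Hx Hrho) as (d & Hd & Hcd).
      assert (Hnear : forall s z', 0 <= s <= 1 -> Rabs (s - x) < d -> D z' ->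
        f z' = c s -> Cmod (g z' - g z) <= k * Cmod (c s - c x)).
      { intros s z' Hs Hsx Hz' Hfz'; rewrite <- Hfz, <- Hfz'.
        apply Hg; [exact Hz'|]; apply Hback; [exact Hz'|].
        rewrite Hfz, Hfz'; apply Hcd; assumption. }
      assert (Hz_uniq : forall z', D z' -> f z' = c x -> z' = z)
        by (intros z' Hz' Hfz'; apply Huniv; congruence).
      exists d; split; [exact Hd|]; intros s s' Hs Hs' Hds Hds' HPs.
      (* The tag [x] becomes a vertex: the path goes from [s] to [x] to [s']. *)
      apply (Hext x s' k); try lra.
      + intros z0 z' Hz0 Hz' Hfz0 Hfz'; rewrite (Hz_uniq z0 Hz0 Hfz0).
        apply Hnear; [lra| |assumption..]; apply Rabs_def1; lra.
      + apply (Hext s x k); try lra; try exact HPs.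
        intros z0 z' Hz0 Hz' Hfz0 Hfz'; rewrite (Hz_uniq z' Hz' Hfz').
        rewrite <- (Cmod_opp (g z - g z0)), <- (Cmod_opp (c x - c s)).
        replace (- (g z - g z0))%C with (g z0 - g z)%C by ring.
        replace (- (c x - c s))%C with (c s - c x)%C by ring.
        apply Hnear; [lra| |assumption..]; apply Rabs_def1; lra. }
  destruct HP1 as (k & n & t & Hk & HkM & Ht & HP).
  exists k; split; [exact Hk|split; [exact HkM|]].
  eapply Rle_trans; [apply HP; [exact Hz2|congruence]|].
  apply Rmult_le_compat_l; [exact Hk|].
  exact (inscribed_length_le_path_length c 0 1 L t n Hlen Ht).
Qed.

Lemma inverse_continuous_of_open (D : C -> Prop) (f : C -> C) (z : C) (r : R) :
  univalent_on D f ->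
  (exists r', 0 < r' <= r /\ (forall p, Cmod (p - z) < r' -> D p) /\
   exists rho, 0 < rho /\ forall w, Cmod (w - f z) < rho ->
     exists p, Cmod (p - z) < r' /\ f p = w) ->
  exists rho, 0 < rho /\
     forall z', D z' -> Cmod (f z' - f z) < rho -> Cmod (z' - z) < r.
Proof.
  intros Huniv (r' & Hr' & HD & rho & Hrho & Hopen).
  exists rho; split; [exact Hrho|]; intros z' Hz' Hw.
  destruct (Hopen (f z') Hw) as (p & Hp & Hfp).
  replace z' with p; [lra|]; apply Huniv; auto.
Qed.

Lemma path_length_ge_dist (c : R -> C) (a b L : R) :
  a <= b -> Rbar_le (path_length c a b) (Finite L) -> Cmod (c b - c a) <= L.
Proof.
  intros Hab HL.
  assert (Ht : Defs.subdivision a b (fun k => match k with O => a | S _ => b end) 0).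
  { split; [reflexivity|split; [reflexivity|]].
    intros k Hk; replace k with 0%nat by lia; exact Hab. }
  generalize (inscribed_length_le_path_length c a b L _ _ HL Ht).
  unfold inscribed_length; rewrite sum_O; trivial.
Qed.

Theorem theorem2 (f h g : C -> C) (M : R)
  (h_holo : holomorphic_on unit_disk h)
  (g_holo : holomorphic_on unit_disk g)
  (f_decomp : forall z : C, unit_disk z -> f z = (h z + Cconj (g z))%C)
  (f_sense : sense_preserving_on unit_disk f)
  (f_univ : univalent_on unit_disk f)
  (Omega_lc : linearly_connected (image unit_disk f) M)
  (omega_bound : forall z : C, unit_disk z ->
     Cmod (dilatation h g z) < 1 / (1 + M)) :
  univalent_on unit_disk h.
Proof.
  intros z1 z2 Hz1 Hz2 Hh.
  destruct (excluded_middle_informative (z1 = z2)) as [|Hne]; [assumption|].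
  exfalso.
  set (l := Cmod (f z1 - f z2)).
  assert (Hl : 0 < l).
  { apply Cmod_gt_0; intros E; apply Hne, f_univ; [assumption..|].
    replace (f z1) with (f z1 - f z2 + f z2)%C by ring; rewrite E; ring. }
  destruct (Omega_lc (f z1) (f z2)) as (c & Hc & Hlen);
    [exists z1; auto|exists z2; auto|].
  fold l in Hlen.
  (* A path is at least as long as its chord. *)
  assert (HM : 1 <= M).
  { generalize (path_length_ge_dist c 0 1 _ Rle_0_1 Hlen).
    destruct Hc as (_ & _ & -> & ->).
    rewrite <- Cmod_opp.
    replace (- (f z2 - f z1))%C with (f z1 - f z2)%C by ring; fold l; nra. }
  assert (Hdisk : forall z, unit_disk z -> 0 < 1 - Cmod z)
    by (unfold unit_disk; intros; lra).
  assert (Hf : forall z, unit_disk z ->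
    wirtinger_at f z (C_derive h z) (C_derive g z)).
  { intros z Hz.
    apply (wirtinger_at_harmonic f h g z _ _ (1 - Cmod z)); auto.
    - intros z' Hz'; apply f_decomp, (unit_disk_open z z' Hz').
    - apply wirtinger_at_holomorphic, h_holo, Hz.
    - apply wirtinger_at_holomorphic, g_holo, Hz. }
  assert (Hab : forall z, unit_disk z ->
    Cmod (C_derive g z) < Cmod (C_derive h z)).
  { intros z Hz; generalize (f_sense z Hz).
    rewrite (jacobian_wirtinger f z _ _ (Hf z Hz)).
    generalize (Cmod_ge_0 (C_derive g z)) (Cmod_ge_0 (C_derive h z)); nra. }
  assert (Hsmall : forall z, unit_disk z ->
    (1 + M) * Cmod (C_derive g z) < Cmod (C_derive h z)).
  { intros z Hz; generalize (omega_bound z Hz) (Hab z Hz); unfold dilatation.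
    intros Hom Hlt; generalize (Cmod_ge_0 (C_derive g z)); intros Hg0.
    rewrite Cmod_div in Hom by (apply Cmod_gt_0; lra).
    apply (Rmult_lt_compat_r (Cmod (C_derive h z) * (1 + M))) in Hom; [|nra].
    field_simplify in Hom; lra. }
  destruct (variation_along_path unit_disk f g c M (M * l) z1 z2)
    as (k & Hk & HkM & Hvar); auto.
  - intros z Hz.
    destruct (conjugate_part_locally_dominated f h g z
      (C_derive h z) (C_derive g z) M (1 - Cmod z)) as (k & d & Hk & HkM & Hd & H);
      auto.
    + lra.
    + intros z' Hz'; apply f_decomp, (unit_disk_open z z' Hz').
    + apply wirtinger_at_holomorphic, h_holo, Hz.
    + apply wirtinger_at_holomorphic, g_holo, Hz.
    + exists k, d; auto.
  - intros z r Hz Hr; apply inverse_continuous_of_open; [exact f_univ|].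
    exists (Rmin r (1 - Cmod z)); split; [split|split].
    + apply Rmin_glb_lt; auto.
    + apply Rmin_l.
    + intros p Hp; apply Rmin_Rgt_l in Hp as [_ Hp].
      exact (unit_disk_open z p Hp).
    + apply (wirtinger_locally_onto f (C_derive h) (C_derive g)).
      * apply Rmin_glb_lt; auto.
      * intros p Hp; apply Rmin_Rgt_l in Hp as [_ Hp].
        apply unit_disk_open in Hp; auto.
  - replace (Cmod (g z2 - g z1)) with l in Hvar; [nra|].
    unfold l; rewrite (f_decomp z1 Hz1), (f_decomp z2 Hz2), Hh.
    rewrite <- Cmod_opp, <- (Cmod_conj (g z2 - g z1)), Cminus_conj.
    apply f_equal; ring.
Qed.
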